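(* Let $(X,\leq)$ be a poset of bountiful structures under the consecutive order, that is, $X$ is the set of all structures of some bountiful type and $\leq$ is the consecutive order. Then the atomicity problem is decidable for $(X,\leq)$: it is decidable, given a finite set $B\subseteq X$, whether $\mathrm{Av}(B)$ is atomic.
   Context: Conventions: $\mathbb{N}=\{1,2,3,\dots\}$ and $[m,n]=\{m,m+1,\dots,n\}$. Structures. A structure is a pair $(X,R)$ with $X$ a finite subset of $\mathbb{N}$ and $R$ a sequence of relations on $X$, the first of which is the linear order on $X$ inherited from $\mathbb{N}$. The sequence of arities of the relations in $R$ is the signature. Structures are of the same type if they have the same signature and, perhaps, satisfy certain additional conditions. Two structures of the same type are isomorphic ($\cong$) if relabelling the points of each in increasing order by $1,2,\dots$ gives exactly the same structure; isomorphic structures are considered equal, so every structure may be taken to have underlying set $[1,n]$ for some $n\in\mathbb{N}$. The length of $(X,R)$ is $|(X,R)|=|X|$. For $Y\subseteq X$, $\sigma\upharpoonright_Y$ is the restriction of $\sigma$ to the points in $Y$. Consecutive order: for $\sigma,\rho$ of the same type, $\sigma\leq\rho$ iff $\sigma\cong\rho\upharpoonright_{[k,k+|\sigma|-1]}$ for some $k\ge 1$ with $k+|\sigma|-1\le|\rho|$. Valid types. Let $\sigma,\rho$ be structures of the same type with $|\sigma|=p$, $|\rho|=q$. They overlap (on $x$ points) if $\sigma\upharpoonright_{[p-x+1,p]}\cong\rho\upharpoonright_{[1,x]}$ for some $x\geq 1$. A structure $\theta$ of the same type with $|\theta|=p+q-x$ combines them if $\theta\upharpoonright_{[1,p]}\cong\sigma$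 and $\theta\upharpoonright_{[p-x+1,p+q-x]}\cong\rho$. A type is valid if for any two overlapping structures of this type there is a structure of the same type which combines them. Bountiful types. A valid type is bountiful if for any structures $\sigma,\rho$ of this type with $|\sigma|=|\rho|=m$ for some $m\in\mathbb{N}$ and $\sigma\upharpoonright_{[2,m]}\cong\rho\upharpoonright_{[1,m-1]}$ (for $m=1$ both are restrictions to the empty set), there exist at least two structures $\theta_1,\theta_2$ of the same type and of length $m+1$ with $\theta_i\upharpoonright_{[1,m]}\cong\sigma$ and $\theta_i\upharpoonright_{[2,m+1]}\cong\rho$ for $i=1,2$. Avoidance sets: $\mathrm{Av}(B)=\{x\in X: \beta\nleq x \text{ for all } \beta\in B\}$. A downward closed subset $C$ of a poset is atomic if it is not the union of two downward closed proper subsets of $C$; equivalently (joint embedding property) for all $x,y\in C$ there is $z\in C$ with $x,y\leq z$.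
   Formalization: Membership in the bountiful type is additionally assumed to be decidable (the claim fails for types defined by undecidable conditions), and a type is read as closed under restriction to nonempty intervals. *)

(* Defs.v *)
From HB Require Import structures.
From mathcomp Require Import all_boot.
From mathcomp Require Import boolp classical_sets.

Set Implicit Arguments.
Unset Strict Implicit.
Unset Printing Implicit Defensive.

Local Open Scope classical_set_scope.

(* * Structures *)

(* A signature is 2 :: ar: the leading 2 stands for the linear order and [ar]
   lists the arities of the other relations.  Every structure is taken with
   underlying set [1,n], represented by 'I_n (the point p is the ordinal p - 1).
   Its linear order is then the order of 'I_n, so only the relations listed in
   [ar] are recorded, and isomorphism of structures is Leibniz equality. *)
Definition relations (ar : seq nat) (n : nat) : finType :=
  {dffun forall i : 'I_(size ar), {set (nth 0 ar i).-tuple 'I_n}}.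

Definition structure (ar : seq nat) : Type := {n : nat & relations ar n}.
HB.instance Definition _ (ar : seq nat) := Equality.on (structure ar).

Definition len (ar : seq nat) (s : structure ar) : nat := tag s.

Definition rels (ar : seq nat) (s : structure ar) : relations ar (len s) :=
  tagged s.

Lemma restr_pt_subproof (a b n : nat) (j : 'I_(minn b n - a.-1)) :
  a.-1 + j < n.
Proof. by rewrite -ltn_subRL (leq_trans (ltn_ord j)) // leq_sub2r // geq_minr. Qed.

(* The (j+1)-st point, in increasing order, of [a,b] inside [1,n] (a >= 1). *)
Definition restr_pt (a b n : nat) (j : 'I_(minn b n - a.-1)) : 'I_n :=
  Ordinal (restr_pt_subproof j).

(* The restriction of [s] to the points in [a,b] (a >= 1), relabelled in
   increasing order by 1, 2, ... *)
Definition restr (ar : seq nat) (s : structure ar) (a b : nat) : structure ar :=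
  existT (fun n => relations ar n) (minn b (len s) - a.-1)
    ([ffun i : 'I_(size ar) =>
        [set t : (nth 0 ar i).-tuple 'I_(minn b (len s) - a.-1)
           | map_tuple (@restr_pt a b (len s)) t \in rels s i]%SET]
     : relations ar (minn b (len s) - a.-1)).

(* The consecutive order. *)
Definition cons_le (ar : seq nat) (s r : structure ar) : Prop :=
  exists2 k : nat, 1 <= k /\ k + len s - 1 <= len r
                 & s = restr r k (k + len s - 1).

(* * Types of structures *)

(* The structures of a type are those of a given signature, possibly subject to
   further conditions.  As positive integers start at 1, arities and lengths are
   positive.  Comparing restrictions as structures of the type presupposes that
   they are of this type; only restrictions to intervals are ever used. *)
Record structure_type (ar : seq nat) (X : set (structure ar)) : Prop :=
  StructureType {
    type_arity : all (leq 1) ar;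
    type_nonempty : forall s, X s -> 1 <= len s;
    type_restr : forall s a b, X s -> 1 <= a -> a <= b -> b <= len s ->
                 X (restr s a b) }.

Definition overlap (ar : seq nat) (s r : structure ar) (x : nat) : Prop :=
  [/\ 1 <= x, x <= len s, x <= len r
    & restr s (len s - x + 1) (len s) = restr r 1 x].

Definition combines (ar : seq nat) (s r : structure ar) (x : nat)
    (t : structure ar) : Prop :=
  [/\ len t = len s + len r - x,
      restr t 1 (len s) = s
    & restr t (len s - x + 1) (len s + len r - x) = r].

Definition valid_type (ar : seq nat) (X : set (structure ar)) : Prop :=
  structure_type X /\
  forall (s r : structure ar) (x : nat), X s -> X r -> overlap s r x ->
    exists2 t, X t & combines s r x t.

(* For m = 1 both restrictions are empty and, arities being positive, equal. *)
Definition bountiful_type (ar : seq nat) (X : set (structure ar)) : Prop :=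
  valid_type X /\
  forall (m : nat) (s r : structure ar), X s -> X r -> len s = m -> len r = m ->
    restr s 2 m = restr r 1 (m - 1) ->
    exists t1 t2 : structure ar,
      [/\ t1 <> t2,
          [/\ X t1, len t1 = m + 1, restr t1 1 m = s & restr t1 2 (m + 1) = r]
        & [/\ X t2, len t2 = m + 1, restr t2 1 m = s & restr t2 2 (m + 1) = r]].

(* * Atomicity *)

Definition avoid (T : eqType) (le : T -> T -> Prop) (X : set T) (B : seq T)
    : set T :=
  [set x | X x /\ forall b, b \in B -> ~ le b x].

Definition down_closed (T : Type) (le : T -> T -> Prop) (X D : set T) : Prop :=
  D `<=` X /\ forall x y, D x -> X y -> le y x -> D y.

Definition atomic (T : Type) (le : T -> T -> Prop) (X C : set T) : Prop :=
  down_closed le X C /\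
  ~ exists D E : set T,
      [/\ down_closed le X D, down_closed le X E, D `<` C, E `<` C
        & C = D `|` E].

(* * Decidability *)

(* The total (general) recursive functions on natural numbers. *)
Inductive recursive : forall k : nat, (k.-tuple nat -> nat) -> Prop :=
| rec_zero k : recursive (fun _ : k.-tuple nat => 0)
| rec_succ : recursive (fun v : 1.-tuple nat => (thead v).+1)
| rec_proj k (i : 'I_k) : recursive (fun v : k.-tuple nat => tnth v i)
| rec_comp k m (g : m.-tuple nat -> nat) (h : 'I_m -> k.-tuple nat -> nat) :
    recursive g -> (forall i, recursive (h i)) ->
    recursive (fun v : k.-tuple nat => g [tuple h i v | i < m])
| rec_prim k (g : k.-tuple nat -> nat) (h : k.+2.-tuple nat -> nat) :
    recursive g -> recursive h ->
    recursive (fun v : k.+1.-tuple nat =>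
      nat_rec (fun _ => nat) (g (behead_tuple v))
        (fun n y => h (cons_tuple n (cons_tuple y (behead_tuple v)))) (thead v))
(* minimization of a regular function: h v is the least y with g (y, v) = 0 *)
| rec_min k (g : k.+1.-tuple nat -> nat) (h : k.-tuple nat -> nat) :
    recursive g ->
    (forall v, g (cons_tuple (h v) v) = 0 /\
               forall y, y < h v -> g (cons_tuple y v) <> 0) ->
    recursive h.

(* The problem "given an input x satisfying the promise [D], does P x hold?",
   inputs being presented through their codes, is decided by an algorithm. *)
Definition decidable_problem (T : Type) (code : T -> nat) (D P : T -> Prop)
    : Prop :=
  exists2 f : 1.-tuple nat -> nat, recursive f
    & forall x, D x -> (P x <-> f [tuple code x] = 1).

(* A k-ary relation on 'I_n as the number whose bit in position
   t_0 + t_1 * n + ... + t_(k-1) * n ^ (k-1) tells whether it contains t. *)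
Definition code_relation (n k : nat) (A : {set k.-tuple 'I_n}) : nat :=
  \sum_(t in A) 2 ^ (\sum_(j < k) tnth t j * n ^ j).

Definition code_structure (ar : seq nat) (s : structure ar) : nat :=
  CodeSeq.code (len s :: [seq code_relation (rels s i) | i : 'I_(size ar)]).

Definition code_structures (ar : seq nat) (B : seq (structure ar)) : nat :=
  CodeSeq.code [seq code_structure s | s <- B].

Definition decidable_type (ar : seq nat) (X : set (structure ar)) : Prop :=
  decidable_problem (@code_structure ar) setT X.

(* A finite subset of X is given by a list of its elements. *)
Definition atomicity_problem_decidable (ar : seq nat) (X : set (structure ar))
    : Prop :=
  decidable_problem (@code_structures ar)
    (fun B => forall b, b \in B -> X b)
    (fun B => atomic (@cons_le ar) X (avoid (@cons_le ar) X B)).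

(* Main.v *)
Require Import Defs.
From mathcomp Require Import all_boot.
From mathcomp Require Import boolp classical_sets.
From mathcomp Require Import zify.

(** Why atomicity is decidable.  Let m >= 1 bound the lengths of the structures
    in B.  Whether a structure of length at least m avoids B can be read off its
    windows of m consecutive points, and validity glues two avoiding structures
    along a common window of m points without creating new windows
    ([avoid_combine]).  So the long avoiding structures are walks in a finite
    graph whose vertices are the avoiding structures of length m.

    Atomicity is the joint embedding property ([atomic_joint_embedding]).  In a
    bountiful type each step s -> r of a walk is realised by two different
    structures of length m + 1.  An avoiding structure that contains both takes
    this step twice, hence returns from r to s in between ([reach_back1]).  So if
    the avoiding structures of length at most m + 1 embed jointly, any vertex
    reaches any other, and gluing along a connecting walk embeds all pairs jointly
    ([bounded_joint_embedding]).  Conversely, if the copies of two such structures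
    lie far apart in an avoiding structure, some window occurs twice between them
    and the part from one occurrence to the other can be cut out ([shorten]).
    Hence the avoidance set is atomic if and only if any two of its members of
    length at most m + 1 embed in a member of length at most V + 2 m + 1, where V
    is at least the number of structures of length m
    ([atomic_bounded_embedding]).

    This condition is a finite check, and it remains to see that the check is a
    recursive function.  The pair of a and b is coded by 2 ^ a * (2 b + 1), which
    also codes the list with head a and tail b.  Functions that act recursively
    on codes are closed under bounded loops and list traversal
    ([computable_foldl]), so the check may be written as a list program
    ([atomicity_test]).  A structure becomes the list of its length and of the
    numbers whose binary digits tabulate its relations.  Since each number below
    2 ^ (n ^ k) tabulates a k-ary relation on n points
    ([code_relation_onto]), the structures of a given length can be enumerated by
    enumerating lists of numbers, and the decision procedure for the type is
    only consulted on codes of structures. *)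

Set Implicit Arguments.
Unset Strict Implicit.
Unset Printing Implicit Defensive.

(** * Windows of structures *)

Section Windows.
Variable ar : seq nat.
Implicit Types (s r t u : structure ar) (i : 'I_(size ar)) (w : seq nat).

(** Membership of a plain list of numbers in the i-th relation.  Structures of
    provably but not definitionally equal lengths are compared through it. *)
Definition holds s i w : bool :=
  [exists u : (nth 0 ar i).-tuple 'I_(len s),
    (map val u == w) && (u \in rels s i)].

Lemma holds_val s i (u : (nth 0 ar i).-tuple 'I_(len s)) :
  holds s i (map val u) = (u \in rels s i).
Proof.
apply/existsP/idP => [[v /andP[/eqP e]]|us]; last by exists u; rewrite eqxx.
by rewrite (_ : v = u) //; apply/val_inj/(inj_map val_inj).
Qed.

Lemma holds_lt s i w : holds s i w -> all (fun x => x < len s) w.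
Proof.
case/existsP=> u /andP[/eqP <- _]; rewrite all_map; apply/allP => x _ /=.
exact: ltn_ord.
Qed.

Lemma structure_eq s r : len s = len r ->
  (forall i w, holds s i w = holds r i w) -> s = r.
Proof.
case: s r => [n S] [n' R]; rewrite /len /= => e; subst n' => h.
congr existT; apply/ffunP => i; apply/setP => u.
by have := h i (map val u); rewrite !holds_val.
Qed.

(** The l points that follow the first p points.  Positions starting at 0 make
    iterated restrictions additive. *)
Definition win s p l : structure ar := restr s p.+1 (p + l).

Lemma win_pos s p q l : p = q -> win s p l = win s q l.
Proof. by move->. Qed.

Lemma len_win s p l : p + l <= len s -> len (win s p l) = l.
Proof. by move=> h; rewrite /len /win /=; move: h; rewrite /len; lia. Qed.

Lemma holds_win s p l i w : p + l <= len s ->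
  holds (win s p l) i w =
  all (fun x => x < l) w && holds s i (map (addn p) w).
Proof.
move=> pl; have L := len_win pl.
apply/existsP/andP => [[u /andP[/eqP <- us]]|[wl /existsP[v /andP[/eqP vw vs]]]].
  split.
    rewrite all_map; apply/allP => x _ /=.
    by apply: leq_trans (ltn_ord x) _; rewrite -[X in _ <= X]L.
  apply/existsP; exists (map_tuple (@restr_pt p.+1 (p + l) (len s)) u).
  move: us; rewrite /rels /= ffunE inE => ->; rewrite andbT.
  by apply/eqP; rewrite -!map_comp; apply: eq_map => x.
have sw : size w == nth 0 ar i.
  by rewrite -(size_map (addn p)) -vw size_map size_tuple.
have sw' : size (pmap (insub : nat -> option 'I_(len (win s p l))) w)
    == nth 0 ar i.
  rewrite size_pmap_sub (eqP (_ : count _ w == size w)) //.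
  rewrite -all_count; apply: sub_all wl => x xl; apply: leq_trans xl _.
  by rewrite -[X in X <= _]L.
have E : map val (Tuple sw') = w.
  rewrite /= pmap_filter => [|x]; last exact: insubK.
  apply/all_filterP; apply: sub_all wl => x xl /=.
  by rewrite insubT // (leq_trans xl) // -[X in X <= _]L.
exists (Tuple sw'); rewrite E eqxx /= /rels /= ffunE inE.
rewrite (_ : map_tuple _ _ = v) //; apply/val_inj/(inj_map val_inj).
by rewrite vw -[in RHS]E -!map_comp; apply: eq_map => x.
Qed.

Lemma win_win s p l q k : p + l <= len s -> q + k <= l ->
  win (win s p l) q k = win s (p + q) k.
Proof.
move=> pl qk; have L := len_win pl.
have pk : p + q + k <= len s by lia.
apply: structure_eq; first by rewrite !len_win ?L.
move=> i w; rewrite !holds_win ?L //.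
case: allP => //= wk; rewrite all_map -map_comp.
have -> /= : all (preim (addn q) (fun x => x < l)) w.
  by apply/allP => x /wk /=; lia.
by congr holds; apply: eq_map => x /=; rewrite addnA.
Qed.

Lemma win_full s : win s 0 (len s) = s.
Proof.
apply: structure_eq; first by rewrite len_win.
move=> i w; rewrite holds_win // map_id.
by case h: (holds _ _); rewrite ?andbF // (holds_lt h).
Qed.

Lemma cons_leP s r : 1 <= len s ->
  cons_le s r <-> exists2 p, p + len s <= len r & s = win r p (len s).
Proof.
move=> s0; split=> [[[|p] [k0 h] e]|[p h e]] //.
  by exists p; [lia|rewrite /win {1}e; congr restr; lia].
exists p.+1; first by split=> //; lia.
by rewrite {1}e; congr restr; lia.
Qed.

Lemma cons_le_refl s : 1 <= len s -> cons_le s s.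
Proof. by move=> s0; apply/cons_leP => //; exists 0; rewrite ?win_full. Qed.

Lemma cons_le_trans s r t : 1 <= len s -> 1 <= len r ->
  cons_le s r -> cons_le r t -> cons_le s t.
Proof.
move=> s0 r0 /(cons_leP _ s0)[p ps es] /(cons_leP _ r0)[q qs er].
apply/cons_leP => //; exists (q + p); first by lia.
by rewrite {1}es er win_win.
Qed.

Lemma cons_le_win r p l : 1 <= l -> p + l <= len r -> cons_le (win r p l) r.
Proof.
by move=> l0 pl; apply/cons_leP; rewrite ?len_win //; exists p.
Qed.

End Windows.

Section Types.
Variables (ar : seq nat) (X : set (structure ar)).
Hypothesis bX : bountiful_type X.
Implicit Types (s r t u : structure ar).

Lemma type_len s : X s -> 1 <= len s.
Proof. by case: bX => -[[_ h _] _] _; apply: h. Qed.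

Lemma type_win s p l : X s -> 1 <= l -> p + l <= len s -> X (win s p l).
Proof. by case: bX => -[[_ _ h] _] _ Xs l0 pl; apply: h => //; lia. Qed.

Lemma type_combine s r x : X s -> X r -> 1 <= x -> x <= len s -> x <= len r ->
  win s (len s - x) x = win r 0 x ->
  exists t, [/\ X t, len t = len s + len r - x, win t 0 (len s) = s
              & win t (len s - x) (len r) = r].
Proof.
case: bX => -[_ vX] _ Xs Xr x0 xs xr e.
have [|t Xt [tl ts tr]] := vX s r x Xs Xr.
  by split=> //; rewrite addn1; move: e; rewrite /win subnK.
exists t; split=> //; rewrite -[RHS]tr /win; congr restr; lia.
Qed.

Lemma type_extend m s r : X s -> X r -> len s = m -> len r = m ->
  win s 1 m.-1 = win r 0 m.-1 ->
  exists t1 t2, [/\ t1 <> t2, X t1, X t2 & forall t, t \in [:: t1; t2] ->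
    [/\ len t = m.+1, win t 0 m = s & win t 1 m = r]].
Proof.
case: bX => _ eX Xs Xr sm rm e; have s0 := type_len Xs.
have [|t1 [t2 [d [X1 L1 A1 B1] [X2 L2 A2 B2]]]] := eX m s r Xs Xr sm rm.
  by rewrite subn1; move: e; rewrite /win add1n prednK // -sm.
exists t1, t2; split=> // t; rewrite !inE.
by rewrite addn1 in L1 L2 B1 B2; case/orP => /eqP->; split.
Qed.

End Types.

(** * Joint embedding in an avoidance set *)

Section Avoidance.
Variables (ar : seq nat) (X : set (structure ar)).
Hypothesis bX : bountiful_type X.
Variable B : seq (structure ar).
Hypothesis BX : forall b, b \in B -> X b.
Implicit Types (s r t u x y z : structure ar).

Local Notation C := (avoid (@cons_le ar) X B).

Lemma avoid_len s : C s -> 1 <= len s.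
Proof. by case=> Xs _; apply: type_len Xs. Qed.

Lemma avoid_down s r : C s -> X r -> cons_le r s -> C r.
Proof.
move=> [Xs Bs] Xr rs; split=> // b bB br; apply: (Bs b bB).
by apply: cons_le_trans br rs; apply: (type_len bX) => //; apply: BX.
Qed.

Lemma avoid_win s p l : C s -> 1 <= l -> p + l <= len s -> C (win s p l).
Proof.
move=> Cs l0 pl; apply: (avoid_down Cs); last exact: cons_le_win.
by case: Cs => Xs _; apply: type_win.
Qed.

Definition joint_embedding :=
  forall x y, C x -> C y -> exists z, [/\ C z, cons_le x z & cons_le y z].

(** If x and y have no common extension, the members not above x and those not
    above y are two proper downward closed subsets that cover everything. *)
Lemma atomic_joint_embedding : atomic (@cons_le ar) X C <-> joint_embedding.
Proof.
have dC : down_closed (@cons_le ar) X C.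
  by split=> [s []//|s r Cs Xr]; apply: avoid_down.
split=> [[_ nDE] x y Cx Cy|jep].
  apply: contrapT => nz; apply: nDE.
  pose outside w := [set v | C v /\ ~ cons_le w v]%classic.
  have sub w : C w ->
      down_closed (@cons_le ar) X (outside w) /\ (outside w `<` C)%classic.
    move=> Cw; split.
      split=> [v [[]]//|v u [Cv wv] Xu uv].
      split; first exact: avoid_down uv.
      move=> wu; apply: wv; apply: cons_le_trans uv => //; first exact: avoid_len.
      exact: type_len Xu.
    split; first by move=> v [].
    by move=> /(_ w Cw)[_]; apply; exact/cons_le_refl/avoid_len.
  have [dx px] := sub x Cx; have [dy py] := sub y Cy.
  exists (outside x), (outside y).
  split=> //; apply/seteqP; split=> [v Cv|v [[]|[]]//].
  have [xv|] := pselect (cons_le x v); last by left.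
  by right; split=> // yv; apply: nz; exists v.
split=> // -[D [E [[_ dD] [_ dE] [_ /existsNP[x /not_implyP[Cx nDx]]]]]].
move=> [_ /existsNP[y /not_implyP[Cy nEy]]] DE.
have [z [Cz xz yz]] := jep x y Cx Cy.
have [Xx _] := Cx; have [Xy _] := Cy.
move: Cz; rewrite DE => -[/dD|/dE] d; first exact: nDx (d _ Xx xz).
exact: nEy (d _ Xy yz).
Qed.

Variable m : nat.
Hypothesis m0 : 1 <= m.
Hypothesis Bm : forall b, b \in B -> len b <= m.

(** A copy of a member of B has at most m points, so it lies inside a window of m
    points. *)
Lemma avoid_local s : X s -> m <= len s ->
  (forall p, p + m <= len s -> C (win s p m)) -> C s.
Proof.
move=> Xs ms Cw; split=> // b bB /cons_leP[|p pb eb].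
  exact/(type_len bX)/BX.
(* The window that starts with the copy of b, or the last one if that runs over. *)
have bm := Bm bB; set q := minn p (len s - m).
have qm : q + m <= len s by lia.
have [_ /(_ b bB)] := Cw q qm; apply.
apply/cons_leP; first exact/(type_len bX)/BX.
exists (p - q); rewrite ?win_win ?len_win // -?eb; try lia.
by rewrite subnKC // geq_minl.
Qed.

(** With an overlap of m points, each window of m points lies in one of the two
    parts, so that nothing forbidden arises across the seam. *)
Lemma avoid_combine s r : C s -> C r -> m <= len s -> m <= len r ->
  win s (len s - m) m = win r 0 m ->
  exists t, [/\ C t, len t = len s + len r - m, win t 0 (len s) = s
              & win t (len s - m) (len r) = r].
Proof.
move=> Cs Cr ms mr e.
have [t [Xt tl ts tr]] := type_combine bX (proj1 Cs) (proj1 Cr) m0 ms mr e.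
exists t; split=> //; apply: avoid_local => //; first by lia.
move=> p pm; have [ps|ps] := leqP (p + m) (len s).
  rewrite -(add0n p) -(@win_win _ t 0 (len s)) ?ts //; last by lia.
  exact: avoid_win.
have -> : p = len s - m + (p - (len s - m)) by lia.
rewrite -(@win_win _ t _ (len r)) ?tr //; try lia.
by apply: avoid_win => //; lia.
Qed.

(** The windows of m points of such a z form a walk from s to r. *)
Definition reach s r := exists z,
  [/\ C z, m <= len z, win z 0 m = s & win z (len z - m) m = r].

Lemma reach_win z p q : C z -> p <= q -> q + m <= len z ->
  reach (win z p m) (win z q m).
Proof.
move=> Cz pq qm; exists (win z p (q - p + m)).
have h : p + (q - p + m) <= len z by lia.
split; rewrite ?len_win ?win_win //; try lia.
- by apply: avoid_win => //; lia.
- by rewrite addn0.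
- by apply: win_pos; lia.
Qed.

Lemma reach_trans s r t : reach s r -> reach r t -> reach s t.
Proof.
move=> [u [Cu mu us ur]] [v [Cv mv vr vt]].
have [|w [Cw wl wu wv]] := avoid_combine Cu Cv mu mv; first by rewrite ur vr.
exists w; split=> //; first by lia.
  by rewrite -us -[in RHS]wu win_win; try lia.
by rewrite -vt -[X in _ = win X _ _]wv win_win; try lia; apply: win_pos; lia.
Qed.

Definition bounded_embedding N := forall x y, C x -> C y ->
  len x <= m.+1 -> len y <= m.+1 ->
  exists z, [/\ C z, len z <= N, cons_le x z & cons_le y z].

Section Bounded.
Variable N : nat.
Hypothesis bemb : bounded_embedding N.

(** Here bountifulness is used: the two structures t1 and t2 that realise the step
    from s to r occur at different places of a common extension.  The walk that
    leaves the first of these places at r arrives at the second one at s. *)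
Lemma reach_back1 z p : C z -> p.+1 + m <= len z ->
  reach (win z p.+1 m) (win z p m).
Proof.
move=> Cz pm; set s := win z p m; set r := win z p.+1 m.
have [ls lr] : len s = m /\ len r = m by rewrite !len_win //; lia.
have [Cs Cr] : C s /\ C r by split; apply: avoid_win => //; lia.
have [|t1 [t2 [d X1 X2 h]]] := type_extend bX (proj1 Cs) (proj1 Cr) ls lr.
  by rewrite /s /r !win_win; try lia; apply: win_pos; lia.
have Ct t : X t -> t \in [:: t1; t2] -> C t.
  move=> Xt /h[lt ts tr]; apply: avoid_local => //; first by lia.
  move=> [|[|q]] qm; rewrite ?ts ?tr //; lia.
have [i1 i2] : t1 \in [:: t1; t2] /\ t2 \in [:: t1; t2].
  by rewrite !inE !eqxx orbT.
have [L1 _ _] := h _ i1; have [L2 _ _] := h _ i2.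
have [||w [Cw _ /cons_leP e1 /cons_leP e2]] := bemb (Ct _ X1 i1) (Ct _ X2 i2).
- by rewrite L1.
- by rewrite L2.
have key u v a b : u \in [:: t1; t2] -> v \in [:: t1; t2] ->
    u = win w a m.+1 -> v = win w b m.+1 -> a < b -> b + m.+1 <= len w ->
    reach r s.
  move=> /h[_ _ ur] /h[_ vs _] eu ev ab bm.
  rewrite -ur -vs eu ev !win_win; try lia.
  by apply: reach_win => //; lia.
have [|a am ea] := e1; first by lia.
have [|b bm eb] := e2; first by lia.
rewrite L1 in am ea; rewrite L2 in bm eb.
have [ab|ba|ab] := ltngtP a b; [exact: (key t1 t2 a b)|exact: (key t2 t1 b a)|].
by case: d; rewrite ea eb ab.
Qed.

Lemma reach_back z p q : C z -> p <= q -> q + m <= len z ->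
  reach (win z q m) (win z p m).
Proof.
move=> Cz; elim: q => [|q IH] pq qm.
  by move: pq; rewrite leqn0 => /eqP->; apply: reach_win.
have [->|pq1] := eqVneq p q.+1; first exact: reach_win.
apply: reach_trans (reach_back1 Cz qm) (IH _ _); lia.
Qed.

Lemma reach_all s r : C s -> C r -> len s = m -> len r = m -> reach s r.
Proof.
move=> Cs Cr ls lr; have [||z [Cz _ sz rz]] := bemb Cs Cr.
- by rewrite ls.
- by rewrite lr.
have [|a am ->] := (cons_leP _ _).1 sz; first by rewrite ls.
have [|b bm ->] := (cons_leP _ _).1 rz; first by rewrite lr.
rewrite !ls !lr in am bm *.
by have /orP[ab|ba] := leq_total a b; [apply: reach_win|apply: reach_back].
Qed.

(** Glue x, a walk from the last window of x to the first window of y, and y. *)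
Lemma joint_long x y : C x -> C y -> m <= len x -> m <= len y ->
  exists z, [/\ C z, cons_le x z & cons_le y z].
Proof.
move=> Cx Cy mx my.
have [||||w [Cw mw wx wy]] := @reach_all (win x (len x - m) m) (win y 0 m);
  rewrite ?len_win; try apply: avoid_win; try lia; try exact: Cx; try exact: Cy.
have [|u [Cu lu ux uw]] := avoid_combine Cx Cw mx mw; first by rewrite wx.
have [||z [Cz lz zu zy]] := avoid_combine Cu Cy _ my; first by lia.
  by rewrite -wy -[X in _ = win X _ _]uw win_win; try lia; apply: win_pos; lia.
exists z; split=> //.
  apply: (@cons_le_trans _ _ u); try exact: avoid_len.
    by rewrite -{1}ux; apply: cons_le_win; [apply: avoid_len|lia].
  by rewrite -{1}zu; apply: cons_le_win; [apply: avoid_len|lia].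
by rewrite -{1}zy; apply: cons_le_win; [apply: avoid_len|lia].
Qed.

Lemma cons_le_len s r : 1 <= len s -> cons_le s r -> len s <= len r.
Proof. by move=> s0 /cons_leP[]//; lia. Qed.

(** As soon as a structure of length m avoids B, embedding the shorter structures
    jointly with it reduces the claim to structures of length at least m. *)
Lemma bounded_joint_embedding : joint_embedding.
Proof.
move=> x y Cx Cy.
have [sm|lg] := boolP ((len x <= m.+1) && (len y <= m.+1)).
  by case/andP: sm => xm ym; have [z [Cz _ xz yz]] := bemb Cx Cy xm ym; exists z.
have [v Cv lv] : exists2 v, C v & len v = m.
  have [xm|xm] := leqP (len x) m.
    by exists (win y 0 m); rewrite ?len_win //; try apply: avoid_win => //; lia.
  by exists (win x 0 m); rewrite ?len_win //; try apply: avoid_win => //; lia.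
have pad u : C u -> exists u', [/\ C u', cons_le u u' & m <= len u'].
  move=> Cu; have [um|um] := leqP m (len u).
    by exists u; split=> //; exact/cons_le_refl/avoid_len.
  have [||z [Cz _ uz vz]] := bemb Cu Cv; [lia|lia|].
  by exists z; split=> //; rewrite -lv; apply: cons_le_len => //; apply: avoid_len.
have [x' [Cx' xx mx]] := pad x Cx; have [y' [Cy' yy my]] := pad y Cy.
have [z [Cz xz yz]] := joint_long Cx' Cy' mx my.
exists z; split=> //; [apply: cons_le_trans xx xz|apply: cons_le_trans yy yz];
  exact: avoid_len.
Qed.

End Bounded.

(** Pigeonhole: V + 1 windows start at i, ..., i + V, and they take at most V
    values. *)
Lemma repeated_window z i V : #|relations ar m| <= V -> i + V + m <= len z ->
  exists p q, [/\ i <= p, p < q, q <= i + V & win z p m = win z q m].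
Proof.
move=> cV iV; pose W := [seq win z (i + k) m | k <- iota 0 V.+1].
have : ~~ uniq W.
  apply/negP => /uniq_leq_size uW.
  have := uW [seq existT (fun n => relations ar n) m R | R : relations ar m] _.
  rewrite size_map size_iota size_map -cardE => h.
  suff : V < V by rewrite ltnn.
  apply: leq_trans cV; apply: h => _ /mapP[k ik ->].
  rewrite mem_iota in ik.
  have : len (win z (i + k) m) = m by rewrite len_win; lia.
  case: (win _ _ _) => n R; rewrite /len /= => e; subst n.
  by apply: map_f; rewrite mem_enum.
case/(uniqPn z) => a [b [ab bV e]]; move: bV e; rewrite size_map size_iota => bV.
rewrite !(nth_map 0) ?size_iota ?nth_iota; try lia; rewrite !add0n => e.
by exists (i + a), (i + b); split=> //; lia.
Qed.

(** If y starts more than V + m points after x, some window is repeated strictly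
    after the start of x and no later than the start of y; gluing the parts before
    and after the repetition gives a shorter structure that keeps both copies.
    Otherwise the interval spanned by the two copies is short enough. *)
Lemma shorten V x y z i j : #|relations ar m| <= V ->
  C z -> i <= j -> len x <= m.+1 -> len y <= m.+1 -> 1 <= len x -> 1 <= len y ->
  i + len x <= len z -> j + len y <= len z ->
  x = win z i (len x) -> y = win z j (len y) ->
  exists z', [/\ C z', len z' <= V + m.*2.+1, cons_le x z' & cons_le y z'].
Proof.
move=> cV; have [n] := ubnP (len z); elim: n => // n IH in z i j *.
move=> zn Cz ij xm ym x0 y0 ix jy ex ey.
have [ji|ji] := leqP (j - i) (V + m).
  have h : i + maxn (len x) (j - i + len y) <= len z by lia.
  exists (win z i (maxn (len x) (j - i + len y))); split.
  - by apply: avoid_win => //; lia.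
  - by rewrite len_win; lia.
  - apply/cons_leP => //; exists 0; rewrite ?len_win ?win_win ?addn0 //; lia.
  - apply/cons_leP => //; exists (j - i); rewrite ?len_win ?win_win ?subnKC //; lia.
have [|p [q [ip pq qV e]]] := @repeated_window z i.+1 V cV; first by lia.
have ha : 0 + (p + m) <= len z by lia.
have hb : q + (len z - q) <= len z by lia.
have [|||||t [Ct lt ta tb]] :=
    @avoid_combine (win z 0 (p + m)) (win z q (len z - q));
  rewrite ?len_win //; try (apply: avoid_win => //); try lia.
  by rewrite !win_win; try lia; rewrite addnK addn0.
rewrite !len_win // in lt ta tb.
apply: (IH t i (p + (j - q))) => //; try lia.
  by rewrite {1}ex -[LHS](@win_win _ z 0 (p + m)) -?ta ?win_win ?add0n //; lia.
rewrite {1}ey -[in LHS](subnKC (_ : q <= j)); last by lia.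
rewrite -(@win_win _ z _ (len z - q)); try lia.
by rewrite -tb win_win; try lia; rewrite addnK.
Qed.

Lemma joint_embedding_bounded V : #|relations ar m| <= V ->
  joint_embedding -> bounded_embedding (V + m.*2.+1).
Proof.
move=> cV jep x y Cx Cy xm ym; have [z [Cz xz yz]] := jep x y Cx Cy.
have x0 := avoid_len Cx; have y0 := avoid_len Cy.
have [i ix ex] := (cons_leP _ x0).1 xz; have [j jy ey] := (cons_leP _ y0).1 yz.
have /orP[ij|ji] := leq_total i j.
  exact: shorten cV Cz ij xm ym x0 y0 ix jy ex ey.
have [w [Cw lw yw xw]] := shorten cV Cz ji ym xm y0 x0 jy ix ey ex.
by exists w.
Qed.

Lemma atomic_bounded_embedding V : #|relations ar m| <= V ->
  atomic (@cons_le ar) X C <-> bounded_embedding (V + m.*2.+1).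
Proof.
move=> cV; rewrite atomic_joint_embedding.
by split; [exact: joint_embedding_bounded|exact: bounded_joint_embedding].
Qed.

End Avoidance.

(** * Recursive functions on numbers *)

Lemma recursive_ext k (f g : k.-tuple nat -> nat) :
  recursive f -> f =1 g -> recursive g.
Proof. by move=> rf /funext <-. Qed.

Lemma recursive_nth k i : i < k -> recursive (fun v : k.-tuple nat => nth 0 v i).
Proof.
move=> ik; apply: recursive_ext (rec_proj (Ordinal ik)) _ => v.
by rewrite (tnth_nth 0).
Qed.

Definition recursive1 (f : nat -> nat) :=
  recursive (fun v : 1.-tuple nat => f (nth 0 v 0)).
Definition recursive2 (f : nat -> nat -> nat) :=
  recursive (fun v : 2.-tuple nat => f (nth 0 v 0) (nth 0 v 1)).
Definition recursive3 (f : nat -> nat -> nat -> nat) :=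
  recursive (fun v : 3.-tuple nat => f (nth 0 v 0) (nth 0 v 1) (nth 0 v 2)).

Lemma recursive_app1 k f (g : k.-tuple nat -> nat) :
  recursive1 f -> recursive g -> recursive (fun v => f (g v)).
Proof.
move=> rf rg; apply: recursive_ext (rec_comp rf (fun _ : 'I_1 => rg)) _ => v.
by congr f; apply: (nth_mktuple (fun=> g v) 0 ord0).
Qed.

Lemma recursive_app2 k f (g1 g2 : k.-tuple nat -> nat) :
  recursive2 f -> recursive g1 -> recursive g2 ->
  recursive (fun v => f (g1 v) (g2 v)).
Proof.
move=> rf r1 r2; pose g (i : 'I_2) := nth g2 [:: g1; g2] i.
have rg i : recursive (g i) by case: i => [[|[|[]]]].
apply: recursive_ext (rec_comp rf rg) _ => v.
have E (i : 'I_2) := nth_mktuple (fun i => g i v) 0 i.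
by have /= -> := E ord0; have /= -> := E (lift ord0 ord0).
Qed.

Lemma recursive_succn : recursive1 succn.
Proof.
by apply: recursive_ext rec_succ _ => v; rewrite /thead (tnth_nth 0).
Qed.

Lemma recursive_const k c : recursive (fun _ : k.-tuple nat => c).
Proof.
elim: c => [|c IH]; first exact: rec_zero.
exact: (recursive_app1 recursive_succn).
Qed.

Lemma recursive_prim f h : recursive1 f -> recursive3 h ->
  recursive2 (fun n a => nat_rec _ (f a) (fun i y => h i y a) n).
Proof.
move=> rf rh; apply: recursive_ext (rec_prim rf rh) _.
by case/tupleP => n v; case/tupleP: v => a v.
Qed.

(** Primitive recursion runs on the first argument. *)
Lemma recursive_swap f : recursive2 f -> recursive2 (fun a b => f b a).
Proof. by move=> rf; apply: recursive_app2 rf _ _; apply: recursive_nth. Qed.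

Lemma recursive_addn : recursive2 addn.
Proof.
apply: recursive_ext (@recursive_prim id (fun _ y _ => y.+1) _ _) _.
- exact: recursive_nth.
- by apply: (recursive_app1 recursive_succn); apply: recursive_nth.
- by move=> v /=; elim: (nth 0 v 0) => //= n ->.
Qed.

Lemma recursive_muln : recursive2 muln.
Proof.
apply: recursive_ext (@recursive_prim (fun=> 0) (fun _ y a => a + y) _ _) _.
- exact: recursive_const.
- by apply: (recursive_app2 recursive_addn); apply: recursive_nth.
- by move=> v /=; elim: (nth 0 v 0) => //= n ->.
Qed.

Lemma recursive_expn : recursive2 expn.
Proof.
apply: (@recursive_swap (fun n a => a ^ n)).
apply: recursive_ext (@recursive_prim (fun=> 1) (fun _ y a => a * y) _ _) _.
- exact: recursive_const.
- by apply: (recursive_app2 recursive_muln); apply: recursive_nth.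
- by move=> v /=; elim: (nth 0 v 0) => [|n IH]; rewrite ?expn0 ?expnS -?IH.
Qed.

Lemma recursive_predn : recursive1 predn.
Proof.
have r : recursive2 (fun n _ => n.-1).
  apply: recursive_ext (@recursive_prim (fun=> 0) (fun n _ _ => n) _ _) _.
  - exact: recursive_const.
  - exact: recursive_nth.
  - by move=> v /=; case: (nth 0 v 0).
exact: (recursive_app2 r (@recursive_nth 1 0 isT) (@recursive_nth 1 0 isT)).
Qed.

Lemma recursive_subn : recursive2 subn.
Proof.
apply: (@recursive_swap (fun n a => a - n)).
apply: recursive_ext (@recursive_prim id (fun _ y _ => y.-1) _ _) _.
- exact: recursive_nth.
- by apply: (recursive_app1 recursive_predn); apply: recursive_nth.
- by move=> v /=; elim: (nth 0 v 0) => /= [|n ->]; rewrite ?subn0 ?subnS.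
Qed.

(** The quotient is the least q with z < (q + 1) d; the outer factor d forces the
    value 0 when d = 0. *)
Lemma recursive_divn : recursive2 divn.
Proof.
pose g (v : 3.-tuple nat) :=
  ((nth 0 v 1).+1 - (nth 0 v 0).+1 * nth 0 v 2) * nth 0 v 2.
apply: (@rec_min 2 g) => [|v].
  apply: (recursive_app2 recursive_muln); last exact: recursive_nth.
  apply: (recursive_app2 recursive_subn).
    by apply: (recursive_app1 recursive_succn); apply: recursive_nth.
  apply: (recursive_app2 recursive_muln); last exact: recursive_nth.
  by apply: (recursive_app1 recursive_succn); apply: recursive_nth.
rewrite /g /=; move: (nth 0 v 0) (nth 0 v 1) => z d.
have [->|d0] := posnP d; first by rewrite divn0 !muln0.
split=> [|y].
  by rewrite (eqP (_ : _ - _ == 0)) // subn_eq0 ltn_ceil.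
rewrite leq_divRL // => yz; apply/eqP; rewrite muln_eq0 negb_or subn_eq0.
rewrite -lt0n d0 andbT -ltnNge ltnS; lia.
Qed.

(** [CodeSeq.code (a :: s)] is by definition the pair of [a] and the code of [s],
    so that one pairing serves both products and lists. *)
Definition pairn a b := 2 ^ a * b.*2.+1.
Definition fstn z := logn 2 z.
Definition sndn z := z %/ 2 ^ (fstn z).+1.

Lemma pairnK1 a b : fstn (pairn a b) = a.
Proof.
rewrite /fstn /pairn lognM ?expn_gt0 // lognX.
rewrite (@lognE 2 b.*2.+1) /= dvdn2 /= odd_double /= addn0.
by rewrite (@logn_prime 2 2) ?muln1.
Qed.

Lemma pairnK2 a b : sndn (pairn a b) = b.
Proof.
rewrite /sndn pairnK1 /pairn expnSr divnMA mulKn ?expn_gt0 //.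
by rewrite divn2 /= uphalf_double.
Qed.

Lemma pairn_gt0 a b : 0 < pairn a b.
Proof. by rewrite muln_gt0 expn_gt0. Qed.

Lemma ltn_pairn a b : b < pairn a b.
Proof.
apply: (@leq_trans b.*2.+1); first by rewrite ltnS -addnn leq_addr.
by rewrite leq_pmull // expn_gt0.
Qed.

Lemma recursive_pairn : recursive2 pairn.
Proof.
apply: (recursive_app2 recursive_muln).
  apply: (recursive_app2 recursive_expn); first exact: recursive_const.
  exact: recursive_nth.
apply: (recursive_app1 recursive_succn).
apply: recursive_ext (_ : recursive (fun v : 2.-tuple nat =>
  nth 0 v 1 + nth 0 v 1)) _.
  by apply: (recursive_app2 recursive_addn); apply: recursive_nth.
by move=> v; rewrite addnn.
Qed.

(** The exponent of 2 in z is the least e for which 2 ^ (e + 1) does not divide z,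
    with value 0 at z = 0. *)
Lemma recursive_fstn : recursive1 fstn.
Proof.
pose g (v : 2.-tuple nat) := nth 0 v 1 *
  (1 - (nth 0 v 1 - (nth 0 v 1 %/ 2 ^ (nth 0 v 0).+1) * 2 ^ (nth 0 v 0).+1)).
apply: (@rec_min 1 g) => [|v].
  have r1 : recursive (fun v : 2.-tuple nat => nth 0 v 1) by apply: recursive_nth.
  have r2 : recursive (fun v : 2.-tuple nat => 2 ^ (nth 0 v 0).+1).
    apply: (recursive_app2 recursive_expn); first exact: recursive_const.
    by apply: (recursive_app1 recursive_succn); apply: recursive_nth.
  apply: (recursive_app2 recursive_muln) => //.
  apply: (recursive_app2 recursive_subn); first exact: recursive_const.
  apply: (recursive_app2 recursive_subn) => //.
  apply: (recursive_app2 recursive_muln) => //.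
  exact: (recursive_app2 recursive_divn).
rewrite /g /=; move: (nth 0 v 0) => z; rewrite /fstn.
have [->|z0] := posnP z; first by rewrite logn0.
have E d : z - z %/ d * d = z %% d by rewrite {1}(divn_eq z d) addKn.
split=> [|y]; rewrite E.
  rewrite (_ : 1 - _ = 0) ?muln0 //; apply/eqP; rewrite subn_eq0 lt0n.
  by rewrite -[_ == 0]/(_ %| z) pfactor_dvdn // ltnn.
rewrite -(@pfactor_dvdn 2) // => /eqP ->; lia.
Qed.

Lemma recursive_sndn : recursive1 sndn.
Proof.
apply: (recursive_app2 recursive_divn); first exact: recursive_nth.
apply: (recursive_app2 recursive_expn); first exact: recursive_const.
apply: (recursive_app1 recursive_succn).
by apply: (recursive_app1 recursive_fstn); apply: recursive_nth.
Qed.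

Lemma recursive_comp1 f g : recursive1 f -> recursive1 g -> recursive1 (f \o g).
Proof. exact: recursive_app1. Qed.

Lemma recursive_iter f g : recursive1 f -> recursive2 g ->
  recursive2 (fun n a => iter n (g a) (f a)).
Proof.
move=> rf rg.
apply: recursive_ext (@recursive_prim f (fun _ y a => g a y) rf _) _.
  by apply: (recursive_app2 rg); apply: recursive_nth.
by move=> v /=; elim: (nth 0 v 0) => //= n ->.
Qed.

(** * Computable functions on coded data *)

Class encodable (T : Type) := encode : T -> nat.
#[global] Instance encodable_nat : encodable nat := id.
#[global] Instance encodable_bool : encodable bool := nat_of_bool.
#[global] Instance encodable_prod A B (cA : encodable A) (cB : encodable B) :
  encodable (A * B) := fun p => pairn (encode p.1) (encode p.2).
#[global] Instance encodable_seq A (cA : encodable A) : encodable (seq A) :=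
  fun s => CodeSeq.code (map encode s).

(** The recursive function is constrained on codes only; its values elsewhere are
    arbitrary. *)
Definition computable A B {cA : encodable A} {cB : encodable B} (f : A -> B) :=
  exists2 r, recursive1 r & forall a, encode (f a) = r (encode a).

Section Combinators.
Context {A B C : Type}.
Context {cA : encodable A} {cB : encodable B} {cC : encodable C}.

Lemma computable_ext (f g : A -> B) : f =1 g -> computable f -> computable g.
Proof. by move=> fg [r rr h]; exists r => // a; rewrite -fg. Qed.

Lemma computable_id : computable (fun a : A => a).
Proof. by exists id => //; apply: recursive_nth. Qed.

Lemma computable_const (b : B) : computable (fun _ : A => b).
Proof. by exists (fun=> encode b) => //; apply: recursive_const. Qed.

Lemma computable_comp (g : B -> C) (f : A -> B) :
  computable g -> computable f -> computable (fun a => g (f a)).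
Proof.
move=> [r rr gr] [q qq fq]; exists (r \o q); first exact: recursive_comp1.
by move=> a; rewrite gr fq.
Qed.

Lemma computable_pair (f : A -> B) (g : A -> C) :
  computable f -> computable g -> computable (fun a => (f a, g a)).
Proof.
move=> [r rr fr] [q qq gq]; exists (fun n => pairn (r n) (q n)).
  exact: recursive_app2 recursive_pairn rr qq.
by move=> a; rewrite -fr -gq.
Qed.

Lemma computable_fst (f : A -> B * C) :
  computable f -> computable (fun a => (f a).1).
Proof.
move=> [r rr fr]; exists (fun n => fstn (r n)).
  exact: recursive_app1 recursive_fstn rr.
by move=> a; rewrite -fr pairnK1.
Qed.

Lemma computable_snd (f : A -> B * C) :
  computable f -> computable (fun a => (f a).2).
Proof.
move=> [r rr fr]; exists (fun n => sndn (r n)).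
  exact: recursive_app1 recursive_sndn rr.
by move=> a; rewrite -fr pairnK2.
Qed.

Lemma computable_op1 op (f : A -> nat) :
  recursive1 op -> computable f -> computable (fun a => op (f a)).
Proof.
move=> rop [r rr fr]; exists (fun n => op (r n)).
  exact: recursive_app1 rop rr.
by move=> a; rewrite -fr.
Qed.

Lemma computable_op2 op (f g : A -> nat) : recursive2 op ->
  computable f -> computable g -> computable (fun a => op (f a) (g a)).
Proof.
move=> rop [r rr fr] [q qq gq]; exists (fun n => op (r n) (q n)).
  exact: recursive_app2 rop rr qq.
by move=> a; rewrite -fr -gq.
Qed.

Lemma computable_iter (n : A -> nat) (f : A -> B) (g : A * B -> B) :
  computable n -> computable f -> computable g ->
  computable (fun a => iter (n a) (fun b => g (a, b)) (f a)).
Proof.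
move=> [p pp np] [r rr fr] [q qq gq].
exists (fun k => iter (p k) (fun y => q (pairn k y)) (r k)).
  have rg : recursive2 (fun k y => q (pairn k y)).
    exact: recursive_app1 qq recursive_pairn.
  exact: recursive_app2 (recursive_iter rr rg) pp (@recursive_nth 1 0 isT).
by move=> a; rewrite -np; elim: (n a : nat) => [|k IH] //=; rewrite gq -IH.
Qed.

Lemma computable_cons (x : A -> B) (l : A -> seq B) :
  computable x -> computable l -> computable (fun a => x a :: l a).
Proof.
move=> [r rr fr] [q qq gq]; exists (fun n => pairn (r n) (q n)).
  exact: recursive_app2 recursive_pairn rr qq.
by move=> a; rewrite -fr -gq.
Qed.

Lemma computable_if (b : A -> bool) (f g : A -> B) :
  computable b -> computable f -> computable g ->
  computable (fun a => if b a then f a else g a).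
Proof.
move=> [p pp bp] [r rr fr] [q qq gq].
exists (fun n => p n * r n + (1 - p n) * q n).
  apply: (recursive_app2 recursive_addn);
    apply: (recursive_app2 recursive_muln) => //.
  by apply: (recursive_app2 recursive_subn) => //; apply: recursive_const.
move=> a; rewrite -bp -fr -gq; case: (b a);
  by rewrite /encode /= ?mul1n ?mul0n ?addn0.
Qed.

(** The loop keeps the accumulator and the rest of the list.  It runs as many times
    as the code of the list says, which is at least its length; once the list is
    exhausted, its code is 0 and the state no longer changes. *)
Lemma computable_foldl (f : A -> B) (g : A -> B -> C -> B) (l : A -> seq C) :
  computable f -> computable (fun p : A * (B * C) => g p.1 p.2.1 p.2.2) ->
  computable l -> computable (fun a => foldl (g a) (f a) (l a)).
Proof.
move=> [r rr fr] [q qq gq] [p pp lp].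
pose step k st := pairn
  (if sndn st != 0 then q (pairn k (pairn (fstn st) (fstn (sndn st))))
   else fstn st)
  (sndn (sndn st)).
(* Truncated subtraction turns a number into the indicator of being nonzero. *)
have rif (b c d : 2.-tuple nat -> nat) :
    recursive b -> recursive c -> recursive d ->
    recursive (fun v => if b v != 0 then c v else d v).
  move=> rb rc rd.
  apply: recursive_ext (_ : recursive (fun v =>
      (1 - b v) * d v + (1 - (1 - b v)) * c v)) _; last first.
    move=> v; case: (b v) => /= [|n];
      by rewrite ?subSS ?sub0n ?subn0 ?mul1n ?mul0n ?addn0.
  have r1 : recursive (fun v => 1 - b v).
    by apply: (recursive_app2 recursive_subn) => //; apply: recursive_const.
  apply: (recursive_app2 recursive_addn);
    apply: (recursive_app2 recursive_muln) => //.
  by apply: (recursive_app2 recursive_subn) => //; apply: recursive_const.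
have rstep : recursive2 step.
  have r0 : recursive (fun v : 2.-tuple nat => nth 0 v 0) by apply: recursive_nth.
  have r1 : recursive (fun v : 2.-tuple nat => nth 0 v 1) by apply: recursive_nth.
  have f1 := recursive_app1 recursive_fstn r1.
  have s1 := recursive_app1 recursive_sndn r1.
  apply: (recursive_app2 recursive_pairn);
    last exact: recursive_app1 recursive_sndn s1.
  apply: rif => //; apply: (recursive_app1 qq).
  apply: (recursive_app2 recursive_pairn) => //.
  apply: (recursive_app2 recursive_pairn) => //.
  exact: recursive_app1 recursive_fstn s1.
exists (fun k => fstn (iter (p k) (step k) (pairn (r k) (p k)))).
  apply: (recursive_app1 recursive_fstn).
  have ri : recursive2 (fun n k => iter n (step k) (pairn (r k) (p k))).
    apply: (@recursive_iter (fun k => pairn (r k) (p k))) => //.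
    exact: recursive_app2 recursive_pairn rr pp.
  exact: recursive_app2 ri pp (@recursive_nth 1 0 isT).
move=> a; rewrite -lp -fr.
have size_code (s : seq C) : size s <= encode s.
  by elim: s => //= c s IH; apply: leq_ltn_trans IH _; apply: ltn_pairn.
have loop : forall (s : seq C) n b, size s <= n -> encode (foldl (g a) b s) =
  fstn (iter n (step (encode a)) (pairn (encode b) (encode s))); last exact: loop.
elim=> [|c s IH] n b.
  move=> _; rewrite -[encode [::]]/0.
  have -> : iter n (step (encode a)) (pairn (encode b) 0) =
      pairn (encode b) 0; last by rewrite pairnK1.
  elim: n => //= n ->; rewrite /step pairnK2 /= pairnK1.
  by rewrite (_ : sndn 0 = 0) // /sndn div0n.
case: n => // n /= sn; rewrite -iterS iterSr (IH n) //; congr (fstn (iter n _ _)).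
rewrite /step pairnK2 pairnK1.
rewrite (_ : encode (c :: s) = pairn (encode c) (encode s)) //.
by rewrite -lt0n pairn_gt0 pairnK1 pairnK2 -(gq (a, (b, c))).
Qed.

End Combinators.

(** Proves that a composite of operations known to be computable is computable.
    Free variables are projections of the argument, since binders are turned into
    pairs.  The two hooks are extended once more operations are available. *)
Ltac computable_step := fail.
Ltac computable_named := fail.

Ltac computability :=
  first
  [ assumption | simple eapply computable_id | simple eapply computable_const
  | (first [ simple eapply computable_fst | simple eapply computable_snd
           | simple eapply computable_pair | simple eapply computable_cons
           | simple eapply computable_if | computable_step | computable_named
           | match goal with
             | H : computable ?f |- computable (fun x => ?f (@?g x)) =>
               refine (@computable_comp _ _ _ _ _ _ f g H _)
             end ]);
    computability ].

Lemma computable_app2 A B B' C {cA : encodable A} {cB : encodable B}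
    {cB' : encodable B'} {cC : encodable C} (h : B -> B' -> C) f g :
  computable (fun p : B * B' => h p.1 p.2) -> computable f -> computable g ->
  computable (fun a : A => h (f a) (g a)).
Proof.
by move=> ch cf cg; have := computable_comp ch (computable_pair cf cg).
Qed.

Lemma computable_rev A B {cA : encodable A} {cB : encodable B} (l : A -> seq B) :
  computable l -> computable (fun a => rev (l a)).
Proof.
move=> cl; apply: (@computable_ext _ _ _ _
    (fun a => foldl (fun s x => x :: s) [::] (l a))).
  move=> a; rewrite -[l a in LHS]revK foldl_rev.
  by elim: (rev (l a)) => //= x s ->.
apply: (computable_foldl (g := fun _ s x => x :: s)) => //;
  computability.
Qed.

Lemma computable_foldr A B C {cA : encodable A} {cB : encodable B}
    {cC : encodable C} (z : A -> B) (g : A -> C -> B -> B) (l : A -> seq C) :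
  computable z -> computable (fun p : A * (C * B) => g p.1 p.2.1 p.2.2) ->
  computable l -> computable (fun a => foldr (g a) (z a) (l a)).
Proof.
move=> cz cg cl; apply: (@computable_ext _ _ _ _
    (fun a => foldl (fun y x => g a x y) (z a) (rev (l a)))).
  by move=> a; rewrite foldl_rev.
apply: (computable_foldl cz); last exact: computable_rev.
have cq : computable (fun p : A * (B * C) => (p.1, (p.2.2, p.2.1))).
  by computability.
exact: computable_comp cg cq.
Qed.

Section Lists.
Context {A B C : Type}.
Context {cA : encodable A} {cB : encodable B} {cC : encodable C}.

Lemma computable_map (g : A -> C -> B) (l : A -> seq C) :
  computable (fun p : A * C => g p.1 p.2) -> computable l ->
  computable (fun a => [seq g a x | x <- l a]).
Proof.
move=> cg cl; apply: (computable_foldr (g := fun a x s => g a x :: s)) => //.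
  computability.
apply: computable_cons; last by computability.
by apply: (computable_app2 cg); computability.
Qed.

Lemma computable_all (g : A -> C -> bool) (l : A -> seq C) :
  computable (fun p : A * C => g p.1 p.2) -> computable l ->
  computable (fun a => all (g a) (l a)).
Proof.
move=> cg cl; apply: (computable_foldr (g := fun a x b => g a x && b)) => //.
  computability.
apply: computable_if; [|computability|computability].
by apply: (computable_app2 cg); computability.
Qed.

Lemma computable_has (g : A -> C -> bool) (l : A -> seq C) :
  computable (fun p : A * C => g p.1 p.2) -> computable l ->
  computable (fun a => has (g a) (l a)).
Proof.
move=> cg cl; apply: (computable_foldr (g := fun a x b => g a x || b)) => //.
  computability.
apply: computable_if; [|computability|computability].
by apply: (computable_app2 cg); computability.
Qed.

Lemma computable_filter (g : A -> C -> bool) (l : A -> seq C) :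
  computable (fun p : A * C => g p.1 p.2) -> computable l ->
  computable (fun a => [seq x <- l a | g a x]).
Proof.
move=> cg cl.
apply: (computable_foldr (g := fun a x s => if g a x then x :: s else s)) => //.
  computability.
apply: computable_if; [|computability|computability].
by apply: (computable_app2 cg); computability.
Qed.

Lemma computable_size (l : A -> seq C) :
  computable l -> computable (fun a => size (l a)).
Proof.
move=> cl; apply: (computable_foldr (g := fun _ _ n => n.+1)) => //.
  computability.
by apply: (computable_op1 recursive_succn); computability.
Qed.

Lemma computable_cat (l l' : A -> seq C) :
  computable l -> computable l' -> computable (fun a => l a ++ l' a).
Proof.
move=> cl cl'; apply: (@computable_ext _ _ _ _
    (fun a => foldr cons (l' a) (l a))).
  by move=> a; elim: (l a) => //= x s ->.
by apply: (computable_foldr (g := fun _ x s => x :: s)) => //; computability.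
Qed.

End Lists.

Lemma computable_flatten A C {cA : encodable A} {cC : encodable C}
    (l : A -> seq (seq C)) :
  computable l -> computable (fun a => flatten (l a)).
Proof.
move=> cl; apply: (computable_foldr (g := fun _ x s => x ++ s)) => //.
  computability.
by apply: computable_cat; computability.
Qed.

Section Numbers.
Context {A : Type} {cA : encodable A}.
Implicit Types (f g : A -> nat) (l : A -> seq nat).

Lemma computable_odd f : computable f -> computable (fun a => odd (f a)).
Proof.
move=> [r rr fr]; exists (fun n => r n - r n %/ 2 * 2) => [|a].
  apply: (recursive_app2 recursive_subn) => //.
  apply: (recursive_app2 recursive_muln); last exact: recursive_const.
  by apply: (recursive_app2 recursive_divn) => //; apply: recursive_const.
rewrite -fr -[encode (f a)]/(f a : nat); move: (f a) => n.
by rewrite {2}(divn_eq n 2) addKn modn2.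
Qed.

Lemma computable_leq f g : computable f -> computable g ->
  computable (fun a => f a <= g a).
Proof.
move=> [r rr fr] [q qq gq]; exists (fun n => 1 - (r n - q n)) => [|a].
  apply: (recursive_app2 recursive_subn); first exact: recursive_const.
  exact: (recursive_app2 recursive_subn).
rewrite -fr -gq /leq -[encode (f a)]/(f a) -[encode (g a)]/(g a).
by case: (f a - g a).
Qed.

Lemma computable_eqn f g : computable f -> computable g ->
  computable (fun a => f a == g a).
Proof.
move=> cf cg; apply: (@computable_ext _ _ _ _
    (fun a => if f a <= g a then g a <= f a else false)).
  by move=> a; rewrite eqn_leq.
by apply: computable_if; [apply: computable_leq..|computability].
Qed.

Lemma computable_eqb (b c : A -> bool) : computable b -> computable c ->
  computable (fun a => b a == c a).
Proof.
move=> cb cc; apply: (@computable_ext _ _ _ _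
    (fun a => if b a then c a else if c a then false else true)).
  by move=> a; case: (b a); case: (c a).
by computability.
Qed.

Lemma computable_and (b c : A -> bool) : computable b -> computable c ->
  computable (fun a => b a && c a).
Proof. by move=> cb cc; apply: computable_if => //; computability. Qed.

Lemma computable_neg (b : A -> bool) :
  computable b -> computable (fun a => ~~ b a).
Proof. by move=> cb; apply: computable_if => //; computability. Qed.

Lemma computable_head l : computable l -> computable (fun a => head 0 (l a)).
Proof.
move=> [r rr fr]; exists (fun n => fstn (r n)) => [|a].
  exact: recursive_app1 recursive_fstn rr.
rewrite -fr; case: (l a) => [|x s] /=; first by rewrite /fstn logn0.
by rewrite (_ : encode (x :: s) = pairn x (encode s)) // pairnK1.
Qed.

Lemma computable_behead l : computable l -> computable (fun a => behead (l a)).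
Proof.
move=> [r rr fr]; exists (fun n => sndn (r n)) => [|a].
  exact: recursive_app1 recursive_sndn rr.
rewrite -fr; case: (l a) => [|x s] /=; first by rewrite /sndn div0n.
by rewrite (_ : encode (x :: s) = pairn x (encode s)) // pairnK2.
Qed.

End Numbers.

Lemma computable_iota A {cA : encodable A} (f : A -> nat) :
  computable f -> computable (fun a => iota 0 (f a)).
Proof.
move=> cf; apply: (@computable_ext _ _ _ _
    (fun a => rev (iter (f a) (fun s => size s :: s) [::]))).
  move=> a; apply: (can_inj revK); rewrite revK.
  elim: (f a : nat) => [|n IH] //.
  by rewrite iterS IH size_rev size_iota -addn1 iotaD rev_cat.
apply: computable_rev.
apply: (computable_iter (g := fun p : A * seq nat => size p.2 :: p.2)) => //.
  computability.
apply: computable_cons; last by computability.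
by apply: computable_size; computability.
Qed.

Lemma computable_nth A {cA : encodable A} (l : A -> seq nat) (f : A -> nat) :
  computable l -> computable f -> computable (fun a => nth 0 (l a) (f a)).
Proof.
move=> cl cf; apply: (@computable_ext _ _ _ _
    (fun a => head 0 (iter (f a) behead (l a)))).
  move=> a; elim: (f a : nat) (l a) => [|n IH] s; first by rewrite nth0.
  by rewrite iterSr IH nth_behead.
apply: computable_head.
apply: (computable_iter (g := fun p : A * seq nat => behead p.2)) => //.
by apply: computable_behead; computability.
Qed.

Section Ops.
Context {A : Type} {cA : encodable A}.
Implicit Types (f g : A -> nat).

Lemma computable_addn f g :
  computable f -> computable g -> computable (fun a => f a + g a).
Proof. exact: computable_op2 recursive_addn. Qed.

Lemma computable_muln f g :
  computable f -> computable g -> computable (fun a => f a * g a).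
Proof. exact: computable_op2 recursive_muln. Qed.

Lemma computable_expn f g :
  computable f -> computable g -> computable (fun a => f a ^ g a).
Proof. exact: computable_op2 recursive_expn. Qed.

Lemma computable_divn f g :
  computable f -> computable g -> computable (fun a => f a %/ g a).
Proof. exact: computable_op2 recursive_divn. Qed.

Lemma computable_succn f : computable f -> computable (fun a => (f a).+1).
Proof. exact: computable_op1 recursive_succn. Qed.

End Ops.

Ltac computable_step ::= first [ simple eapply computable_rev
  | simple eapply computable_size
  | simple eapply computable_cat
  | simple eapply computable_flatten
  | simple eapply computable_odd
  | simple eapply computable_leq
  | simple eapply computable_eqn
  | simple eapply computable_eqb
  | simple eapply computable_and
  | simple eapply computable_neg
  | simple eapply computable_head
  | simple eapply computable_iota
  | simple eapply computable_nth
  | simple eapply computable_addn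
  | simple eapply computable_muln
  | simple eapply computable_expn
  | simple eapply computable_divn
  | simple eapply computable_succn
  | simple eapply computable_map
  | simple eapply computable_all
  | simple eapply computable_has
  | simple eapply computable_filter ]; cbv beta.

(** * The decision procedure *)

Definition testbit c q := odd (c %/ 2 ^ q).

(** The index of the binary digit that records the tuple w in the number coding a
    relation on n points. *)
Definition position n (w : seq nat) := foldr (fun x p => x + n * p) 0 w.

Definition words n k : seq (seq nat) :=
  iter k (fun W => flatten [seq [seq x :: w | w <- W] | x <- iota 0 n]) [:: [::]].

(** In the list of a structure the length comes first, so that the i-th relation
    is entry i + 1. *)
Definition agree (ar : seq nat) p (u v : seq nat) : bool :=
  all (fun i => all (fun w =>
         testbit (nth 0 u i.+1) (position (head 0 u) w) ==
         testbit (nth 0 v i.+1) (position (head 0 v) [seq p + x | x <- w]))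
       (words (head 0 u) (nth 0 ar i)))
    (iota 0 (size ar)).

Definition embeds ar (u v : seq nat) : bool :=
  has (fun p => (p + head 0 u <= head 0 v) && agree ar p u v)
    (iota 0 (head 0 v).+1).

Definition relation_codes (ar : seq nat) n : seq (seq nat) :=
  foldr (fun k L =>
    flatten [seq [seq c :: u | u <- L] | c <- iota 0 (2 ^ (n ^ k))]) [:: [::]] ar.

Definition structure_codes ar n : seq (seq nat) :=
  [seq n :: u | u <- relation_codes ar n].

(** Here [o] stands for a decision procedure for the type, which acts on codes. *)
Definition avoids ar (o : nat -> nat) (B : seq (seq nat)) (u : seq nat) : bool :=
  (o (encode u) == 1) && all (fun b => ~~ embeds ar b u) B.

Definition avoiders ar o B n : seq (seq nat) :=
  flatten [seq [seq u <- structure_codes ar l | avoids ar o B u]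
    | l <- iota 0 n.+1].

(** At least 1, as windows must not be empty. *)
Definition max_len (B : seq (seq nat)) := foldr (fun b n => maxn (head 0 b) n) 1 B.

Definition joined ar (Z : seq (seq nat)) u v : bool :=
  has (fun z => embeds ar u z && embeds ar v z) Z.

Definition atomicity_test ar o (B : seq (seq nat)) : bool :=
  let m := max_len B in
  all (fun u => all (joined ar (avoiders ar o B
                         (size (structure_codes ar m) + m.*2.+1)) u)
                 (avoiders ar o B m.+1))
    (avoiders ar o B m.+1).

Lemma computable_testbit A {cA : encodable A}
    (f : A -> nat) (g : A -> nat) :
  computable f -> computable g -> computable (fun a => testbit (f a) (g a)).
Proof. move=> cf cg; rewrite /testbit; computability. Qed.

Lemma computable_position A {cA : encodable A}
    (f : A -> nat) (u : A -> seq nat) :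
  computable f -> computable u -> computable (fun a => position (f a) (u a)).
Proof.
move=> cf cu; apply: (computable_foldr (g := fun a x p => x + f a * p));
  computability.
Qed.

Lemma computable_words A {cA : encodable A}
    (f : A -> nat) (g : A -> nat) :
  computable f -> computable g -> computable (fun a => words (f a) (g a)).
Proof.
move=> cf cg; apply: (computable_iter (g := fun p : A * seq (seq nat) =>
  flatten [seq [seq x :: w | w <- p.2] | x <- iota 0 (f p.1)])); computability.
Qed.

Ltac computable_named ::= first [ simple eapply computable_testbit
  | simple eapply computable_position | simple eapply computable_words].

Lemma computable_agree (ar : seq nat) A {cA : encodable A}
    (f : A -> nat) (u : A -> seq nat) (v : A -> seq nat) :
  computable f -> computable u -> computable v ->
  computable (fun a => agree ar (f a) (u a) (v a)).
Proof. move=> cf cu cv; rewrite /agree; computability. Qed.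

Lemma computable_embeds (ar : seq nat) A {cA : encodable A}
    (u : A -> seq nat) (v : A -> seq nat) :
  computable u -> computable v -> computable (fun a => embeds ar (u a) (v a)).
Proof.
move=> cu cv; apply: computable_has; last computability.
apply: computable_and; first computability.
apply: computable_agree; computability.
Qed.

Lemma computable_relation_codes (ar : seq nat) A {cA : encodable A}
    (f : A -> nat) :
  computable f -> computable (fun a => relation_codes ar (f a)).
Proof.
move=> cf; apply: (computable_foldr (g := fun a k L =>
  flatten [seq [seq c :: u | u <- L] | c <- iota 0 (2 ^ (f a ^ k))]));
  computability.
Qed.

Lemma computable_structure_codes (ar : seq nat) A {cA : encodable A}
    (f : A -> nat) :
  computable f -> computable (fun a => structure_codes ar (f a)).
Proof.
move=> cf; have cr := computable_relation_codes ar cf; rewrite /structure_codes.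
computability.
Qed.

Lemma computable_avoids (ar : seq nat) o A {cA : encodable A}
    (B : A -> seq (seq nat)) (u : A -> seq nat) :
  recursive1 o ->
  computable B -> computable u -> computable (fun a => avoids ar o (B a) (u a)).
Proof.
move=> ro cB cu; apply: computable_and.
  apply: computable_eqn; last computability.
  have [r rr ur] := cu; exists (o \o r) => [|a]; first exact: recursive_comp1.
  by rewrite /= -ur.
apply: computable_all => //; apply: computable_neg; apply: computable_embeds;
  computability.
Qed.

Lemma computable_avoiders (ar : seq nat) o A {cA : encodable A}
    (B : A -> seq (seq nat)) (f : A -> nat) :
  recursive1 o ->
  computable B -> computable f -> computable (fun a => avoiders ar o (B a) (f a)).
Proof.
move=> ro cB cf; apply: computable_flatten.
apply: computable_map; last computability.
apply: computable_filter; last by apply: computable_structure_codes; computability.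
by apply: computable_avoids; computability.
Qed.

Lemma computable_max_len A {cA : encodable A}
    (B : A -> seq (seq nat)) : computable B -> computable (fun a => max_len (B a)).
Proof.
move=> cB; apply: (computable_foldr (g := fun _ b n => maxn (head 0 b) n)) => //;
  rewrite /maxn; computability.
Qed.

Lemma computable_joined (ar : seq nat) A {cA : encodable A}
    (B : A -> seq (seq nat)) (u : A -> seq nat) (v : A -> seq nat) :
  computable B -> computable u -> computable v ->
  computable (fun a => joined ar (B a) (u a) (v a)).
Proof.
move=> cB cu cv; apply: computable_has => //.
by apply: computable_and; apply: computable_embeds; computability.
Qed.

Lemma computable_atomicity_test ar o :
  recursive1 o -> computable (atomicity_test ar o).
Proof.
move=> ro.
have cB : computable (fun B : seq (seq nat) => B) by exact: computable_id.
have cm := computable_max_len cB.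
have cs := computable_structure_codes ar cm.
have c1 : computable (fun B => avoiders ar o B (max_len B).+1).
  by apply: computable_avoiders; computability.
have c2 : computable (fun B => avoiders ar o B
   (size (structure_codes ar (max_len B)) + (max_len B).*2.+1)).
  apply: computable_avoiders => //.
  apply: (@computable_ext _ _ _ _ (fun B => size (structure_codes ar (max_len B)) +
    (max_len B + max_len B).+1)); first by move=> B; rewrite addnn.
  computability.
have c3 : computable (fun p : seq (seq nat) * seq nat => p.1) by computability.
apply: computable_all => //; apply: computable_all;
  last exact: computable_comp c1 c3.
apply: computable_joined; [|computability..].
by apply: (computable_comp c2); computability.
Qed.

(** * Lists of numbers as structures *)

Lemma position_tuple n k (t : k.-tuple 'I_n) :
  \sum_(j < k) tnth t j * n ^ j = position n (map val t).
Proof.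
elim: k t => [|k IH] t; first by rewrite big_ord0 (tuple0 t).
case/tupleP: t => x t; rewrite big_ord_recl /= expn0 muln1 -IH big_distrr /=.
congr addn; apply: eq_bigr => j _; rewrite expnS mulnCA; congr (_ * (_ * _)).
by congr (val _); rewrite (tnthS x t j).
Qed.

Lemma ltn_position n w : all (fun x => x < n) w -> position n w < n ^ size w.
Proof.
elim: w => [|x w IH] //= /andP[xn /IH]; rewrite expnS.
move: (position n w) (n ^ size w) => p q; nia.
Qed.

(** The entries of w are the base-n digits of its position. *)
Lemma position_inj n w w' : size w = size w' ->
  all (fun x => x < n) w -> all (fun x => x < n) w' ->
  position n w = position n w' -> w = w'.
Proof.
elim: w w' => [|x w IH] [|y w'] //= [sw] /andP[xn wn] /andP[yn wn'] e.
have n0 : 0 < n by apply: leq_ltn_trans xn.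
have /eqP := congr1 (modn^~ n) e.
rewrite ![_ + n * _]addnC ![n * _]mulnC !modnMDl !modn_small //.
move=> /eqP xy; congr (_ :: _) => //; apply: IH => //.
by move/eqP: e; rewrite xy eqn_add2l eqn_pmul2l // => /eqP.
Qed.

Lemma testbit_sum M (b : nat -> bool) q :
  testbit (\sum_(i < M) b i * 2 ^ i) q = (q < M) && b q.
Proof.
rewrite /testbit; elim: q M b => [|q IH] [|M] b; rewrite ?big_ord0 ?div0n //.
all: rewrite big_ord_recl expn0 muln1.
all: rewrite (eq_bigr (fun i : 'I_M => 2 * (b i.+1 * 2 ^ i)))
  => [|i _]; last by rewrite /= expnS mulnCA.
all: rewrite -big_distrr.
  by rewrite divn1 oddD oddM /= addbF; case: (b 0).
rewrite expnS divnMA /= addnC mulnC divnMDl //.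
rewrite (@divn_small (b 0)) ?ltnS ?leq_b1 ?addn0 //.
exact: (IH M (fun i => b i.+1)).
Qed.

Lemma sum_bits_lt M (b : nat -> bool) : \sum_(i < M) b i * 2 ^ i < 2 ^ M.
Proof.
elim: M => [|M IH]; first by rewrite big_ord0.
rewrite big_ord_recr expnS mul2n -addnn /=.
case: (b M); first by rewrite mul1n ltn_add2r.
by rewrite mul0n addn0; apply: leq_trans IH (leq_addr _ _).
Qed.

Section RelationCodes.
Variables n k : nat.
Implicit Types (t : k.-tuple 'I_n) (A : {set k.-tuple 'I_n}).

Lemma position_ord_subproof t : position n (map val t) < n ^ k.
Proof.
have := @ltn_position n (map val t); rewrite size_map size_tuple; apply.
by rewrite all_map; apply/allP => x _ /=; apply: ltn_ord.
Qed.

Definition position_ord t := Ordinal (position_ord_subproof t).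

Lemma position_ord_inj : injective position_ord.
Proof.
move=> t t' [] /position_inj; rewrite !size_map !size_tuple => e.
apply/val_inj/(inj_map val_inj)/e => //; rewrite all_map;
  by apply/allP => x _ /=; apply: ltn_ord.
Qed.

(** Distinct tuples have distinct positions, so the powers of 2 that make up the
    code form a binary expansion. *)
Lemma code_relation_bits A : code_relation A =
  \sum_(i < n ^ k) ((i : nat) \in [seq val j | j in position_ord @: A]) * 2 ^ i.
Proof.
rewrite /code_relation (eq_bigr (fun t => 2 ^ (position_ord t)));
  last by move=> t _; rewrite position_tuple.
rewrite -(big_imset (fun i : 'I_(n ^ k) => 2 ^ i)) /=; last first.
  by move=> ? ? _ _ /position_ord_inj.
rewrite big_mkcond /=; apply: eq_bigr => i _.
rewrite mem_map; last exact: val_inj.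
by rewrite mem_enum; case: (_ \in _); rewrite ?mul1n ?mul0n.
Qed.

Lemma testbit_code_relation A t :
  testbit (code_relation A) (position n (map val t)) = (t \in A).
Proof.
rewrite code_relation_bits (testbit_sum _ (fun i => i \in _)).
rewrite -[position n _]/(val (position_ord t)) ltn_ord.
rewrite mem_map; last exact: val_inj.
by rewrite mem_enum mem_imset //; apply: position_ord_inj.
Qed.

Lemma code_relation_lt A : code_relation A < 2 ^ (n ^ k).
Proof. by rewrite code_relation_bits (sum_bits_lt _ (fun i => i \in _)). Qed.

(** Relations are as many as the numbers below 2 ^ (n ^ k), and their codes are
    pairwise different. *)
Lemma code_relation_onto c : c < 2 ^ (n ^ k) -> exists A, code_relation A = c.
Proof.
move=> cn; pose F A := Ordinal (code_relation_lt A).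
have F_inj : injective F.
  move=> A A' [] e; apply/setP => t.
  by rewrite -!testbit_code_relation e.
have : Ordinal cn \in codom F.
  apply: inj_card_onto F_inj _ _.
  by rewrite card_ord -cardsT -powersetT card_powerset cardsT card_tuple card_ord.
by case/codomP => A /(congr1 val) /= ->; exists A.
Qed.

End RelationCodes.

Lemma mem_words n k w :
  (w \in words n k) = (size w == k) && all (fun x => x < n) w.
Proof.
elim: k w => [|k IH] w; first by rewrite inE; case: w.
rewrite /words /= -/(words n k); apply/flatten_mapP/andP.
  case=> x; rewrite mem_iota => /andP[_ xn] /mapP[v].
  rewrite IH => /andP[sv vn] -> /=.
  by rewrite eqSS sv vn xn.
case: w => [|x w] [] //=; rewrite eqSS => sw /andP[xn wn].
exists x; first by rewrite mem_iota.
by apply: map_f; rewrite IH sw wn.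
Qed.

Lemma mem_relation_codes ar n u : (u \in relation_codes ar n) =
  (size u == size ar) &&
  [forall i : 'I_(size ar), nth 0 u i < 2 ^ (n ^ nth 0 ar i)].
Proof.
elim: ar u => [|k ar IH] u.
  rewrite inE; case: u => //=; rewrite eqxx; symmetry.
  by apply/forallP => -[].
rewrite /=; apply/flatten_mapP/andP.
  case=> c; rewrite mem_iota => /andP[_ cn] /mapP[v].
  rewrite IH => /andP[sv /forallP vn] -> /=; rewrite eqSS sv; split=> //.
  by apply/forallP => -[[|i] ik] //=; apply: (vn (Ordinal (ik : i < size ar))).
case: u => [|c u] [] //=; rewrite eqSS => su /forallP un.
exists c; first by rewrite mem_iota; have := un ord0.
apply: map_f; rewrite IH su; apply/forallP => i.
exact: un (lift ord0 i).
Qed.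

Section StructureCodes.
Variable ar : seq nat.
Implicit Types (s r : structure ar) (i : 'I_(size ar)).

Definition to_list s : seq nat :=
  len s :: [seq code_relation (rels s i) | i : 'I_(size ar)].

Lemma code_structuresE (B : seq (structure ar)) :
  code_structures B = encode (map to_list B).
Proof.
rewrite /code_structures /encode /encodable_seq -map_comp; congr CodeSeq.code.
by apply: eq_map => s; congr CodeSeq.code; symmetry; apply: map_id.
Qed.

Lemma nth_to_list s i : nth 0 (to_list s) i.+1 = code_relation (rels s i).
Proof.
by rewrite /= (nth_map i) ?size_enum_ord // nth_ord_enum.
Qed.

Lemma holds_size s i w : holds s i w -> size w = nth 0 ar i.
Proof. by case/existsP=> u /andP[/eqP <- _]; rewrite size_map size_tuple. Qed.

Lemma holds_testbit s i w : w \in words (len s) (nth 0 ar i) ->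
  holds s i w = testbit (nth 0 (to_list s) i.+1) (position (len s) w).
Proof.
rewrite mem_words => /andP[sw wn].
have sw' : size (pmap (insub : nat -> option 'I_(len s)) w) == nth 0 ar i.
  by rewrite size_pmap_sub (eqP (_ : count _ w == size w)) // -all_count.
have <- : map val (Tuple sw') = w.
  rewrite /= pmap_filter => [|x]; last exact: insubK.
  by apply/all_filterP; apply: sub_all wn => x xl /=; rewrite insubT.
by rewrite holds_val nth_to_list testbit_code_relation.
Qed.

Lemma agreeP s r p : p + len s <= len r ->
  reflect (s = win r p (len s)) (agree ar p (to_list s) (to_list r)).
Proof.
move=> pr; have L := len_win pr; apply: (iffP allP) => [h|e j].
  apply: structure_eq => // i w; rewrite holds_win //.
  have [ww|ww] := boolP (w \in words (len s) (nth 0 ar i)); last first.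
    move: ww; rewrite mem_words negb_and => nw; apply/idP/andP.
      by move=> H; move: nw; rewrite (holds_size H) eqxx (holds_lt H).
    move=> [wl /holds_size]; rewrite size_map => sw.
    by move: nw; rewrite sw eqxx wl.
  have /h/allP/(_ w ww)/eqP : (i : nat) \in iota 0 (size ar).
    by rewrite mem_iota /=.
  rewrite -!holds_testbit // => [->|].
    by move: ww; rewrite mem_words => /andP[_ ->].
  move: ww; rewrite !mem_words size_map => /andP[-> wl]; rewrite all_map.
  by apply: sub_all wl => x /=; lia.
rewrite mem_iota /= add0n => js; apply/allP => w ww.
rewrite -[j]/(val (Ordinal js)) -!holds_testbit //.
  rewrite {1}e holds_win //.
  by move: ww; rewrite mem_words => /andP[_ ->].
move: ww; rewrite !mem_words size_map => /andP[-> wl]; rewrite all_map.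
by apply: sub_all wl => x /=; lia.
Qed.

Lemma embedsP s r : 1 <= len s ->
  reflect (cons_le s r) (embeds ar (to_list s) (to_list r)).
Proof.
move=> s0; apply: (iffP hasP) => [[p _ /andP[pr /agreeP e]]|].
  by apply/cons_leP => //; exists p => //; apply: e.
move/cons_leP => -[] // p pr e; exists p; first by rewrite mem_iota /=; lia.
by apply/andP; split=> //; apply/agreeP.
Qed.

(** The inclusion from left to right ensures that a decision procedure for the type
    is only run on codes of structures, where its answers are meaningful. *)
Lemma mem_structure_codes n u :
  u \in structure_codes ar n <-> exists2 s, len s = n & u = to_list s.
Proof.
split=> [/mapP[v]|[s <- ->]].
  rewrite mem_relation_codes => /andP[/eqP sv /forallP vn] ->.
  have [R hR] := fin_all_exists (fun i => code_relation_onto (vn i)).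
  pose s : structure ar := existT _ n (finfun R).
  exists s => //; congr cons.
  apply: (@eq_from_nth _ 0) => [|j jv]; first by rewrite size_map size_enum_ord.
  rewrite sv in jv; have e : rels s (Ordinal jv) = R (Ordinal jv) by apply: ffunE.
  by have := nth_to_list s (Ordinal jv); rewrite e hR /= => ->.
apply: map_f; rewrite mem_relation_codes size_map size_enum_ord eqxx.
apply/forallP => i; have := nth_to_list s i; rewrite /= => ->.
exact: code_relation_lt.
Qed.

Lemma to_list_inj : injective to_list.
Proof.
move=> s r e; have L : len s = len r by case: e.
have l0 : 0 + len s <= len r by rewrite L.
have/agreeP : agree ar 0 (to_list s) (to_list r).
  rewrite e; apply/allP => i _; apply/allP => w _.
  by rewrite (eq_map (_ : _ =1 id)) // map_id.
by move=> /(_ l0) ->; rewrite L win_full.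
Qed.

Lemma card_structure_codes n : #|relations ar n| <= size (structure_codes ar n).
Proof.
rewrite cardE -(size_map (fun R => to_list (existT _ n R))).
apply: uniq_leq_size => [|u /mapP[R _ ->]].
  rewrite map_inj_uniq ?enum_uniq // => R R' /to_list_inj e.
  have := @eq_Tagged _ (fun n => relations ar n : eqType) (existT _ n R) R'.
  by rewrite /Tagged -e eqxx => /esym/eqP.
by apply/mem_structure_codes; exists (existT _ n R).
Qed.

End StructureCodes.

(** * Correctness of the decision procedure *)

Section Correctness.
Variables (ar : seq nat) (X : set (structure ar)).
Hypothesis bX : bountiful_type X.
Variable o : nat -> nat.
Hypothesis oX : forall s, X s <-> o (encode (to_list s)) = 1.
Variable B : seq (structure ar).
Hypothesis BX : forall b, b \in B -> X b.

Local Notation C := (avoid (@cons_le ar) X B).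
Let B' := map (@to_list ar) B.

Lemma max_len_gt0 : 1 <= max_len B'.
Proof. by rewrite /max_len; elim: B' => //= b l IH; rewrite leq_max IH orbT. Qed.

Lemma max_len_geq b : b \in B -> len b <= max_len B'.
Proof.
rewrite /B'; elim: B => //= c l IH; rewrite inE leq_max => /orP[/eqP->|/IH->].
  by rewrite leqnn.
by rewrite orbT.
Qed.

Lemma avoidsP s : reflect (C s) (avoids ar o B' (to_list s)).
Proof.
apply: (iffP andP) => [[/eqP/oX Xs /allP nB]|[Xs nB]].
  split=> // b bB /embedsP e; move: (nB _ (map_f _ bB)).
  by rewrite e //; apply/(type_len bX)/BX.
split; first exact/eqP/oX.
apply/allP => _ /mapP[b bB ->]; apply/negP => /embedsP e.
by apply: (nB b bB); apply: e; apply/(type_len bX)/BX.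
Qed.

Lemma mem_avoiders n u : u \in avoiders ar o B' n <->
  exists s, [/\ C s, len s <= n & u = to_list s].
Proof.
split=> [/flatten_mapP[l]|[s [Cs sn ->]]].
  rewrite mem_iota mem_filter => ln /andP[au /mem_structure_codes[s sl e]].
  by exists s; split=> //; [apply/avoidsP; rewrite -e|lia].
apply/flatten_mapP; exists (len s); first by rewrite mem_iota; lia.
rewrite mem_filter; apply/andP; split; first exact/avoidsP.
by apply/mem_structure_codes; exists s.
Qed.

Lemma atomicity_testP : atomicity_test ar o B' <-> atomic (@cons_le ar) X C.
Proof.
rewrite (atomic_bounded_embedding bX BX max_len_gt0 max_len_geq
  (@card_structure_codes ar (max_len B'))).
have len0 s : C s -> 1 <= len s by case=> Xs _; apply: type_len Xs.
split=> [/allP h x y Cx Cy xm ym|h].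
  have xC : to_list x \in avoiders ar o B' (max_len B').+1.
    by apply/mem_avoiders; exists x.
  have yC : to_list y \in avoiders ar o B' (max_len B').+1.
    by apply/mem_avoiders; exists y.
  have /hasP[w /mem_avoiders[z [Cz zN ->]] /andP[xz yz]] := allP (h _ xC) _ yC.
  by exists z; split=> //; apply/embedsP => //; apply: len0.
apply/allP => _ /mem_avoiders[x [Cx xm ->]].
apply/allP => _ /mem_avoiders[y [Cy ym ->]].
have [z [Cz zN xz yz]] := h x y Cx Cy xm ym.
apply/hasP; exists (to_list z); first by apply/mem_avoiders; exists z.
by apply/andP; split; apply/embedsP => //; apply: len0.
Qed.

End Correctness.

Theorem corollary8p3 (ar : seq nat) (X : set (structure ar))
    (hX : bountiful_type X) (hdec : decidable_type X) :
  atomicity_problem_decidable X.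
Proof.
have [f rf fX] := hdec; pose o c := f [tuple c].
have ro : recursive1 o.
  apply: recursive_ext rf _ => v; rewrite /o; congr f.
  by case/tupleP: v => x v; rewrite (tuple0 v); apply: val_inj.
have oX s : X s <-> o (encode (to_list s)) = 1.
  rewrite (fX s I) /o (_ : code_structure s = encode (to_list s)) //.
  by congr CodeSeq.code; rewrite map_id.
have [r rr rE] := computable_atomicity_test ar ro.
exists (fun v => r (nth 0 v 0)) => // B BX.
rewrite -(atomicity_testP hX oX BX) code_structuresE /= -rE.
by case: (atomicity_test _ _ _).
Qed.
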